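(* Let $(G,\tau)$ and $(H,\sigma)$ be topological groups and $f:(G,\tau)\to(H,\sigma)$ a continuous surjective homomorphism. If $f$ is semitopological, then $f$ is A-open.
   Context: Topological groups are not assumed Hausdorff. $\mathcal V_{(G,\tau)}(e_G)$ is the filter of all neighborhoods of the neutral element $e_G$ in $(G,\tau)$. For a neighborhood $U$ of $e_G$, a subset $M\subseteq G$ is $U$-thin if $\bigcap\{x^{-1}Ux: x\in M\}$ is a neighborhood of $e_G$. Write $[x,y]=xyx^{-1}y^{-1}$ and, for $g\in G$ and $K\subseteq G$, $[g,K]=\{[g,k]:k\in K\}$. A continuous surjective homomorphism $f:(G,\tau)\to(H,\sigma)$ is semitopological if there exist a topological group $(\widetilde G,\widetilde\tau)$ containing $G$ as a topological normal subgroup (i.e. $G$ is a normal subgroup of $\widetilde G$ and $\widetilde\tau\restriction_G=\tau$) and an open continuous homomorphism $\widetilde f:(\widetilde G,\widetilde\tau)\to(H,\sigma)$ extending $f$. A homomorphism $f:(G,\tau)\to(H,\sigma)$ is A-open if for every $U\in\mathcal V_{(G,\tau)}(e_G)$: (a) there exists $V\in\mathcal V_{(H,\sigma)}(e_H)$ such that $f^{-1}(V)$ is $f^{-1}(f(U))$-thin; (b) for every $g\in G$ there exists $V_g\in\mathcal V_{(H,\sigma)}(e_H)$ such that $[g,f^{-1}(V_g)]\subseteq f^{-1}(f(U))$. *)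

(* Defs.v *)
From HB Require Import structures.
From mathcomp Require Import all_boot all_classical topology.

Set Implicit Arguments.
Unset Strict Implicit.
Unset Printing Implicit Defensive.

Local Open Scope classical_set_scope.
Local Open Scope group_scope.

(* Multiplicative analogue of [topologicalZmodType]; no separation axiom. *)
HB.structure Definition PreTopologicalGroup := {G of Topological G & Group G}.

HB.mixin Record PreTopologicalGroup_isTopologicalGroup G
    & PreTopologicalGroup G := {
  mulg_continuous : continuous (fun x : G * G => x.1 * x.2) ;
  invg_continuous : continuous (fun x : G => x^-1)
}.

#[short(type="topologicalGroupType")]
HB.structure Definition TopologicalGroup :=
  {G of PreTopologicalGroup G & PreTopologicalGroup_isTopologicalGroup G}.

Definition thin (G : topologicalGroupType) (U M : set G) : Prop :=
  nbhs (1 : G) (\bigcap_(x in M) [set x^-1 * u * x | u in U]).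

(* The convention [x, y] = x y x^-1 y^-1 differs from that of the library's
   [~ x, y] = x^-1 y^-1 x y. *)
Definition commutator (G : groupType) (x y : G) : G := x * y * x^-1 * y^-1.

(* [G] sits in [Gt] through an injective homomorphism [i] with normal image
   that induces the topology of [G]. *)
Definition topological_normal_embedding (G Gt : topologicalGroupType)
    (i : {multiplicative G -> Gt}) : Prop :=
  [/\ injective i,
      forall x : Gt, [set x^-1 * y * x | y in range i] `<=` range i
    & @open G = @open (initial_topology i)].

Definition semitopological (G H : topologicalGroupType) (f : G -> H) : Prop :=
  exists (Gt : topologicalGroupType) (i : {multiplicative G -> Gt})
    (ft : {multiplicative Gt -> H}),
    [/\ topological_normal_embedding i,
        continuous ft,
        forall A : set Gt, open A -> open (ft @` A)
      & forall x : G, ft (i x) = f x].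

Definition A_open (G H : topologicalGroupType) (f : G -> H) : Prop :=
  forall U : set G, nbhs (1 : G) U ->
    (exists2 V : set H, nbhs (1 : H) V & thin (f @^-1` (f @` U)) (f @^-1` V))
    /\ (forall g : G, exists2 V : set H, nbhs (1 : H) V &
          [set commutator g k | k in f @^-1` V] `<=` f @^-1` (f @` U)).

(* Main.v *)
Require Import Defs.
From mathcomp Require Import all_boot all_classical topology.

(** Let [ft : Gt -> H] be an open extension of [f], with [G] normal in [Gt].
    Openness lets every element of [H] close to [1] be written [ft v] with
    [v] in [Gt] as close to [1] as desired.  If [f x = ft v], then [f] sends
    the conjugate [x y x^-1], resp. the commutator [[g, x]], to the image
    under [ft] of [v y v^-1], resp. of [[g, v]].  Thus [x], of which only the
    image under [f] is small, has been replaced by the small [v]; in the first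
    case [y] is small as well.  By continuity of the group operations of [Gt]
    the new conjugate and commutator are small, and by normality they lie in
    [G]; hence they lie in the given neighborhood [U] of [1] in [G], and their
    images in [f(U)].  [nbhs_embedding_trace] compares smallness in [G] and in
    [Gt], [conjugate_cvg1] and [commutator_cvg1] express the continuity, and
    [conjugate_in_normal_range] and [commutator_in_normal_range] the
    normality. *)

Set Implicit Arguments.
Unset Strict Implicit.
Unset Printing Implicit Defensive.

Local Open Scope classical_set_scope.
Local Open Scope group_scope.

Lemma multiplicative1 (G H : groupType) (f : {multiplicative G -> H}) :
  f 1 = 1.
Proof. by apply: (mulgI (f 1)); rewrite -gmulfM !mulg1. Qed.

Lemma multiplicativeV (G H : groupType) (f : {multiplicative G -> H}) :
  {morph f : x / x^-1}.
Proof.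
by move=> x; apply: (mulgI (f x)); rewrite -gmulfM !mulgV multiplicative1.
Qed.

Lemma mulg_cvg (T : Type) (F : set_system T) {FF : Filter F}
    (G : topologicalGroupType) (u v : T -> G) (a b : G) :
  u @ F --> a -> v @ F --> b -> (fun t => u t * v t) @ F --> a * b.
Proof.
move=> ua vb; apply: (cvg_comp2 ua vb).
exact: (@mulg_continuous G (a, b)).
Qed.

Lemma invg_cvg (T : Type) (F : set_system T) {FF : Filter F}
    (G : topologicalGroupType) (u : T -> G) (a : G) :
  u @ F --> a -> (fun t => (u t)^-1) @ F --> a^-1.
Proof. by move=> ua; exact: (cvg_comp u _ ua (@invg_continuous G a)). Qed.

Lemma conjugate_cvg1 (G : topologicalGroupType) :
  (fun p : G * G => p.1 * p.2 * p.1^-1) @ (nbhs (1 : G), nbhs (1 : G)) --> (1 : G).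
Proof.
have e : 1 * 1 * 1^-1 = 1 :> G by rewrite mulg1 mulgV.
rewrite -[X in _ --> X]e.
apply: mulg_cvg; last by apply: invg_cvg; exact: cvg_fst.
by apply: mulg_cvg; [exact: cvg_fst|exact: cvg_snd].
Qed.

Lemma commutator_cvg1 (G : topologicalGroupType) (g : G) :
  commutator g @ nbhs (1 : G) --> (1 : G).
Proof.
have e : commutator g 1 = 1 by rewrite /commutator mulg1 mulgV mul1g invg1.
rewrite -[X in _ --> X]e.
apply: mulg_cvg; last by apply: invg_cvg; exact: cvg_id.
apply: mulg_cvg; last exact: cvg_cst.
by apply: mulg_cvg; [exact: cvg_cst|exact: cvg_id].
Qed.

Section TopologicalNormalEmbedding.
Variables (G Gt : topologicalGroupType) (i : {multiplicative G -> Gt}).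
Hypothesis i_emb : topological_normal_embedding i.

Lemma embedding_continuous : continuous i.
Proof.
have [_ _ openGE] := i_emb.
by apply/continuousP => A Aop; rewrite openGE; exists A.
Qed.

Lemma nbhs_embedding_trace (x : G) (U : set G) :
  nbhs x U -> exists2 W : set Gt, nbhs (i x) W & i @^-1` W `<=` U.
Proof.
have [_ _ openGE] := i_emb.
rewrite nbhsE => -[O [Oop Ox] OU].
move: Oop; rewrite openGE => -[W Wop WO].
exists W; last by rewrite WO.
by apply: open_nbhs_nbhs; split=> //; move: Ox; rewrite -WO.
Qed.

Lemma conjugate_in_normal_range (v : Gt) (y : G) :
  range i (v * i y * v^-1).
Proof.
have [_ normal_i _] := i_emb.
by apply: (normal_i v^-1); exists (i y); [exists y|rewrite invgK].
Qed.

(** Here [[g, v] = g (v g^-1 v^-1)] is a product of two elements of the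
    normal subgroup [G]. *)
Lemma commutator_in_normal_range (g : G) (v : Gt) :
  range i (commutator (i g) v).
Proof.
have [z _ iz] := conjugate_in_normal_range v g^-1.
by exists (g * z) => //; rewrite gmulfM iz multiplicativeV /commutator !mulgA.
Qed.

End TopologicalNormalEmbedding.

Lemma open_morphism_nbhs1 (G H : topologicalGroupType)
    (f : {multiplicative G -> H}) (W : set G) :
  (forall A : set G, open A -> open (f @` A)) ->
  nbhs (1 : G) W -> nbhs (1 : H) (f @` W).
Proof.
move=> f_open; rewrite nbhsE => -[O [Oop O1] OW].
apply: (filterS (image_subset f OW)); apply: open_nbhs_nbhs; split.
  exact: f_open.
by exists 1 => //; exact: multiplicative1.
Qed.

Theorem theorem4p12 (G H : topologicalGroupType) (f : {multiplicative G -> H})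
  (f_continuous : continuous f) (f_surjective : range f = [set: H]%classic) :
  semitopological f -> A_open f.
Proof.
move=> [Gt [i [ft [i_emb ft_cont ft_open ftE]]]] U U1.
have [W W1 WU] : exists2 W : set Gt, nbhs (1 : Gt) W & i @^-1` W `<=` U.
  by rewrite -(multiplicative1 i); exact: nbhs_embedding_trace.
have image_small (a : Gt) : W a -> range i a -> (f @` U) (ft a).
  by move=> Wa [y _ iy]; exists y; [apply: WU; rewrite /= iy|rewrite -ftE iy].
split=> [|g].
- have [[W' Y] [/= W'1 Y1] W'YW] := conjugate_cvg1 W1.
  exists (ft @` W'); first exact: open_morphism_nbhs1.
  have iY1 : nbhs (1 : G) (i @^-1` Y).
    by apply: embedding_continuous => //; rewrite multiplicative1.
  apply: filterS iY1 => y Yiy x /= [v W'v vx].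
  (* solving [x^-1 u x = y] for [u] *)
  exists (x * y * x^-1); last by rewrite !mulgA mulVg mul1g mulgVK.
  have -> : f (x * y * x^-1) = ft (v * i y * v^-1).
    by rewrite !gmulfM !multiplicativeV vx ftE.
  apply: image_small; first exact: (W'YW (v, i y)).
  exact: conjugate_in_normal_range.
- exists (ft @` (commutator (i g) @^-1` W)).
    by apply: open_morphism_nbhs1 => //; exact: commutator_cvg1.
  move=> _ [k [v Wv vk] <-] /=.
  have -> : f (commutator g k) = ft (commutator (i g) v).
    by rewrite /commutator !gmulfM !multiplicativeV vk ftE.
  by apply: image_small => //; exact: commutator_in_normal_range.
Qed.
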